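(* Let $T$ be a tree on $n\geq 3$ vertices with exactly $p$ leaves. Then the real symmetric matrix $\mathrm{Max4PC}_T$ has inertia $$(n_0,n_+,n_-)=\left(\binom{n}{2}-2(n-p),\ n-p,\ n-p\right),$$ where $n_0$, $n_+$, $n_-$ are the numbers of zero, positive and negative eigenvalues (with multiplicity).
   Context: For a tree $T$ with vertex set $V$, $|V|=n$, let $d_{x,y}$ denote the distance between vertices $x,y$ in $T$. $\mathrm{Max4PC}_T$ is the $\binom{n}{2}\times\binom{n}{2}$ matrix with rows and columns indexed by the $2$-element subsets of $V$, whose entry in row $\{w,x\}$ and column $\{y,z\}$ is $\max\{d_{w,x}+d_{y,z},\ d_{w,y}+d_{x,z},\ d_{w,z}+d_{x,y}\}$. A leaf is a vertex of degree $1$. *)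

(* Defs.v *)
From HB Require Import structures.
From mathcomp Require Import all_boot all_order all_algebra.
From mathcomp Require Import reals.
Set Implicit Arguments. Unset Strict Implicit. Unset Printing Implicit Defensive.
Import Order.TTheory GRing.Theory Num.Theory.

Definition simple_graph (T : finType) (e : rel T) : Prop :=
  symmetric e /\ irreflexive e.

Definition is_tree (T : finType) (e : rel T) : Prop :=
  [/\ simple_graph e,
      (forall x y : T, connect e x y) &
      (forall s : seq T, uniq s -> cycle e s -> size s < 3)].

Definition leaves (T : finType) (e : rel T) : {set T} :=
  [set v | #|[set u | e v u]| == 1].

Fixpoint walkk (T : finType) (e : rel T) (k : nat) (x y : T) : bool :=
  match k with
  | 0 => x == y
  | k'.+1 => [exists z, e x z && walkk e k' z y]
  end.

(* graph distance: least k with a walk of length k from x to y (searched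
   among 0..#|T|-1, which suffices in a connected graph; the value #|T| is
   returned when y is unreachable, which never happens for trees). *)
Definition dist (T : finType) (e : rel T) (x y : T) : nat :=
  find (fun k => walkk e k x y) (iota 0 #|T|).

Definition fourpt (T : finType) (e : rel T) (w x y z : T) : nat :=
  maxn (dist e w x + dist e y z)
       (maxn (dist e w y + dist e x z) (dist e w z + dist e x y)).

Definition pairs (T : finType) : {pred {set T}} := [pred A : {set T} | #|A| == 2].
Arguments pairs : clear implicits.

(* Entry of Max4PC in row A = {w,x}, column B = {y,z}.  Since fourpt is
   invariant under swapping w,x and under swapping y,z, maximizing over the
   orderings of the two pairs just returns the value. *)
Definition max4pc_entry (T : finType) (e : rel T) (A B : {set T}) : nat :=
  \max_(w in A) \max_(x in A | x != w) \max_(y in B) \max_(z in B | z != y)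
     fourpt e w x y z.

(* Max4PC_T as a real matrix; rows/columns indexed by the 2-subsets of T,
   enumerated via enum_val (the ordering is irrelevant for inertia). *)
Definition Max4PC (R : realType) (T : finType) (e : rel T)
  : 'M[R]_#|pairs T| :=
  (\matrix_(i, j) (max4pc_entry e (enum_val i) (enum_val j))%:R)%R.

(* Inertia (n0, n+, n-) of a square real matrix M: numbers of zero, positive
   and negative eigenvalues counted with multiplicity, where the eigenvalues
   with multiplicity are the roots of the characteristic polynomial, here
   required to split over R (as it does for symmetric M). *)
Definition has_inertia (R : realType) (m : nat) (M : 'M[R]_m)
  (n0 np nn : nat) : Prop :=
  (exists s : seq R,
    [/\ char_poly M = \prod_(x <- s) ('X - x%:P),
        count (fun x => x == 0) s = n0,
        count (fun x => 0 < x) s = np &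
        count (fun x => x < 0) s = nn])%R.

(* Main.v *)
Require Import Defs.
From HB Require Import structures.
From mathcomp Require Import all_boot all_order all_algebra.
From mathcomp Require Import reals.
From mathcomp Require Import zify ring lra.
From mathcomp Require Import complex spectral sesquilinear.

(** Root the tree at a vertex that is not a leaf. The maximum in the four-point
    condition counts every edge [min (k, 4 - k)] times, where [k] of the four
    points lie below it: a pairing falls short of this at an edge only if the
    edge separates its two pairs, and since subtrees are nested or disjoint this
    happens for one of the three pairings at most. For two pairs with [a] and [b] points below the edge this
    weight is [1 - (a - 1) (b - 1) + [a = 1] [b = 1]], and it is [a + b] for the
    edge at a leaf. Non-leaf vertices other than the root name the inner edges,
    so [Max4PC = P^T P - N^T N] where [P] and [N] have one row per non-leaf
    vertex, the row of the root absorbing the rank-two part [f + f^T] left by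
    the constants and the leaf edges. The rows of [P] and [N] together are
    linearly independent, and Sylvester's law of inertia concludes. *)

Set Implicit Arguments. Unset Strict Implicit. Unset Printing Implicit Defensive.
Import Order.TTheory GRing.Theory Num.Theory.

(** * Inertia of a difference of two Gram matrices *)

Section Inertia.
Local Open Scope ring_scope.
Local Open Scope sesquilinear_scope.

Lemma dot_conjC_ge0 (C : numClosedFieldType) n (u : 'rV[C]_n) :
  0 <= (u *m u^t*) 0 0.
Proof. by rewrite !mxE sumr_ge0 // => i _; rewrite !mxE -normCK exprn_ge0. Qed.

(* If there were more than [a] positive entries, some nonzero combination of the
   corresponding rows of [U] would be killed by [A], and the form would be both
   positive and nonpositive on it. *)
Lemma card_pos_diag_le (C : numClosedFieldType) N a b
    (A : 'M[C]_(a, N)) (B : 'M[C]_(b, N)) (U : 'M[C]_N) (d : 'rV[C]_N) :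
  U *m (A^t* *m A - B^t* *m B) *m U^t* = diag_mx d ->
  (#|[set i | (0 < d 0 i)%R]| <= a)%N.
Proof.
move=> UMU; set P := [set i | _]; rewrite leqNgt; apply/negP => a_lt.
pose f (i : 'I_#|P|) := enum_val i.
pose Up := rowsub f U.
have /rowV0Pn[c /sub_kermxP cK c_neq0] : kermx (Up *m A^t*) != 0.
  rewrite -mxrank_eq0 mxrank_ker subn_eq0 -ltnNge.
  exact: leq_ltn_trans (rank_leq_col _) a_lt.
have vA : c *m Up *m A^t* = 0 by rewrite -mulmxA.
have trmxCM m n p (X : 'M[C]_(m, n)) (Y : 'M[C]_(n, p)) :
  (X *m Y)^t* = Y^t* *m X^t* by rewrite trmx_mul map_mxM.
have q_le0 : (c *m Up *m (A^t* *m A - B^t* *m B) *m (c *m Up)^t*) 0 0 <= 0.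
  rewrite mulmxBr !mulmxA vA mul0mx sub0r mulNmx mxE oppr_le0.
  rewrite -[B in _ *m B *m _]trmxCK -mulmxA -trmxCM; exact: dot_conjC_ge0.
have q_sub : Up *m (A^t* *m A - B^t* *m B) *m Up^t* = mxsub f f (diag_mx d).
  rewrite -UMU; apply/matrixP=> i j; rewrite !mxE; apply: eq_bigr => k _.
  by rewrite !mxE; congr (_ * _); apply: eq_bigr => l _; rewrite !mxE.
have [i ci] : exists i, c 0 i != 0.
  apply/existsP; apply: contraNT c_neq0 => /existsPn c0; apply/eqP/rowP => i.
  by rewrite mxE; apply/eqP; move: (c0 i); rewrite negbK.
have d_gt0 j : 0 < d 0 (f j) by have := enum_valP j; rewrite inE.
move: q_le0; rewrite trmxCM !mulmxA -(mulmxA c) -(mulmxA c) q_sub.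
suff -> : (c *m mxsub f f (diag_mx d) *m c^t*) 0 0
    = \sum_j d 0 (f j) * `|c 0 j| ^+ 2.
  have ge0 j : true -> 0 <= d 0 (f j) * `|c 0 j| ^+ 2.
    by move=> _; rewrite mulr_ge0 ?exprn_ge0 // ltW.
  move=> le0; have /eqP : \sum_j d 0 (f j) * `|c 0 j| ^+ 2 = 0.
    by apply: le_anti; rewrite le0 sumr_ge0.
  rewrite psumr_eq0 // => /allP/(_ i (mem_index_enum _)) /=.
  by rewrite mulf_eq0 expf_eq0 normr_eq0 (negPf ci) gt_eqF.
rewrite mxE; apply: eq_bigr => j _; rewrite !mxE (bigD1 j) //= big1.
  by rewrite addr0 !mxE eqxx mulr1n normCK mulrCA mulrA.
by move=> k kj; rewrite !mxE (inj_eq enum_val_inj) (negPf kj) mulr0n mulr0.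
Qed.

(** With [C = col_mx A B], the difference is [C^T J C] for an invertible sign matrix [J], and row
    freeness of [C] lets both outer factors be cancelled from the rank. *)
Lemma mxrank_gram_diff (F : fieldType) N a b
    (A : 'M[F]_(a, N)) (B : 'M[F]_(b, N)) :
  row_free (col_mx A B) -> \rank (A^T *m A - B^T *m B) = (a + b)%N.
Proof.
move=> free.
have -> : A^T *m A - B^T *m B
    = (col_mx A B)^T *m (block_mx 1%:M 0 0 (- 1%:M) *m col_mx A B).
  rewrite tr_col_mx mul_block_col !mul0mx !mul1mx addr0 add0r mulNmx mul1mx.
  by rewrite mul_row_col mulmxN.
rewrite eqmxMfull; last by rewrite /row_full mxrank_tr.
rewrite mxrankMfree // mxrank_unit // unitmxE det_ublock det1 mul1r.
by rewrite -scaleN1r detZ det1 mulr1 unitrX ?unitrN1.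
Qed.

(** The matrix factors through the coordinates where [d] does not vanish. *)
Lemma mxrank_diag_le (F : fieldType) N (d : 'rV[F]_N) :
  (\rank (diag_mx d) <= #|[set i | d 0%R i != 0%R]|)%N.
Proof.
set P := [set i | _]; pose f (i : 'I_#|P|) := enum_val i.
suff -> : diag_mx d = colsub f 1%:M *m rowsub f (diag_mx d).
  exact: leq_trans (mxrankM_maxl _ _) (rank_leq_col _).
apply/matrixP => i j; rewrite !mxE.
have [iP|iNP] := boolP (i \in P); last first.
  have d0 : d 0 i = 0 by apply/eqP; rewrite inE negbK in iNP.
  rewrite d0 mul0rn big1 // => k _; rewrite !mxE.
  case: eqP => [ik|_]; last by rewrite mul0r.
  by rewrite -ik d0 mul0rn mulr0.
rewrite (bigD1 (enum_rank_in iP i)) //= !mxE /f enum_rankK_in // eqxx mul1r.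
rewrite big1 ?addr0 // => k ki; rewrite !mxE; case: eqP => [ik|_].
  by case/eqP: ki; apply: enum_val_inj; rewrite enum_rankK_in.
by rewrite mul0r.
Qed.

Lemma char_poly_conj (F : fieldType) n (P A : 'M[F]_n) :
  P \in unitmx -> char_poly (invmx P *m A *m P) = char_poly A.
Proof.
move=> Pu; rewrite /char_poly.
have PP : map_mx polyC (invmx P) *m map_mx polyC P = 1%:M.
  have <- := map_mxM (@polyC F) (invmx P) P.
  by rewrite mulVmx // map_mx1.
have -> : char_poly_mx (invmx P *m A *m P)
    = map_mx polyC (invmx P) *m char_poly_mx A *m map_mx polyC P.
  rewrite /char_poly_mx mulmxBr mulmxBl !map_mxM -mulmxA.
  by rewrite scalar_mxC -mulmxA PP mulmx1.
by rewrite !det_mulmx mulrAC -det_mulmx PP det1 mul1r.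
Qed.

(** The spectral theorem over the complex numbers diagonalizes the matrix with real eigenvalues. At
    most [a] are positive and at most [b] negative, while the rank forces at least [a + b] nonzero
    ones, so equality holds throughout. *)
Lemma has_inertia_gram_diff (R : realType) N a b
    (A : 'M[R]_(a, N)) (B : 'M[R]_(b, N)) :
  row_free (col_mx A B) ->
  has_inertia (A^T *m A - B^T *m B) (N - (a + b)) a b.
Proof.
move=> free; pose toC := real_complex R.
pose M := A^T *m A - B^T *m B; pose MC := map_mx toC M.
pose AC := map_mx toC A; pose BC := map_mx toC B.
have real_toC m n (X : 'M[R]_(m, n)) : map_mx toC X \is a realmx.
  by apply/mxOverP => i j; rewrite mxE; apply/complex_realP; exists (X i j).
have trC m n (X : 'M[R]_(m, n)) : (map_mx toC X)^t* = map_mx toC X^T.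
  by rewrite -map_trmx realmxC // map_trmx.
have MCE : MC = AC^t* *m AC - BC^t* *m BC.
  by rewrite /MC map_mxB !map_mxM !trC.
have MCherm : MC \is hermsymmx.
  apply: realsym_hermsym; last exact: real_toC.
  apply/is_hermitianmxP; rewrite expr0 scale1r map_mx_id // map_trmx.
  by rewrite /MC /M linearB /= !trmx_mul !trmxK.
pose U := spectralmx MC; pose d := spectral_diag MC.
have Uu : U \in unitmx := spectral_unit _.
have UU : U \is unitarymx := spectral_unitarymx _.
have MCd : MC = invmx U *m diag_mx d *m U.
  by apply/orthomx_spectralP; apply: hermitian_normalmx.
have UMU : U *m MC *m U^t* = diag_mx d.
  by rewrite MCd !mulmxA mulmxV // mul1mx mulmxtVK.
have d_real i : d 0 i \is Num.real.
  by move/mxOverP: (hermitian_spectral_diag_real MCherm); apply.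
pose x i := complex.Re (d 0 i).
have dE i : d 0 i = toC (x i) by rewrite /toC RRe_real.
have pos_le : (#|[set i | (0 < x i)%R]| <= a)%N.
  suff -> : [set i | (0 < x i)%R] = [set i | (0 < d 0 i)%R].
    by apply: (@card_pos_diag_le _ _ _ _ AC BC U); rewrite -MCE.
  by apply/setP => i; rewrite !inE dE ltcR.
(* Negating the form exchanges the roles of [A] and [B]. *)
have neg_le : (#|[set i | (x i < 0)%R]| <= b)%N.
  suff -> : [set i | (x i < 0)%R] = [set i | (0 < (- d) 0 i)%R].
    apply: (@card_pos_diag_le _ _ _ _ BC AC U).
    by rewrite -opprB -MCE mulmxN mulNmx UMU linearN.
  by apply/setP => i; rewrite !inE mxE oppr_gt0 dE ltcR.
have nz_ge : (a + b <= #|[set i | x i != 0%R]|)%N.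
  rewrite -(mxrank_gram_diff free) -(mxrank_map toC) -/M -/MC MCd.
  rewrite mxrankMfree ?row_free_unit // eqmxMfull; last first.
    by rewrite row_full_unit unitmx_inv.
  suff -> : [set i | x i != 0%R] = [set i | d 0%R i != 0%R].
    exact: mxrank_diag_le.
  by apply/setP => i; rewrite !inE dE fmorph_eq0.
have split_nz : #|[set i | x i != 0%R]|
    = (#|[set i | (0 < x i)%R]| + #|[set i | (x i < 0)%R]|)%N.
  rewrite -cardsUI.
  have -> : [set i | (0 < x i)%R] :&: [set i | (x i < 0)%R] = set0.
    by apply/setP => i; rewrite !inE; case: ltgtP.
  rewrite cards0 addn0; apply: eq_card => i.
  by rewrite !inE neq_lt orbC.
have posE : #|[set i | (0 < x i)%R]| = a.
  apply/eqP; rewrite eqn_leq pos_le -(leq_add2r b) (leq_trans nz_ge) //.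
  by rewrite split_nz leq_add2l.
have negE : #|[set i | (x i < 0)%R]| = b.
  apply/eqP; rewrite eqn_leq neg_le -(leq_add2l a) (leq_trans nz_ge) //.
  by rewrite split_nz leq_add2r.
have nz_card : #|[set i | x i != 0%R]| = (a + b)%N.
  by rewrite split_nz posE negE.
have count_x (Q : pred R) :
    count Q [seq x i | i <- enum 'I_N] = #|[set i | Q (x i)]|.
  rewrite count_map cardE [in RHS]/enum_mem size_filter -enumT.
  by apply: eq_count => i /=; rewrite inE.
exists [seq x i | i <- enum 'I_N]; split.
- apply: (map_poly_inj toC); rewrite map_char_poly -/M -/MC MCd.
  rewrite char_poly_conj // char_poly_trig ?diag_mx_is_trig //.
  rewrite rmorph_prod /= big_map big_enum /=; apply: eq_bigr => i _.
  by rewrite !mxE eqxx mulr1n dE rmorphB /= map_polyX map_polyC.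
- have := cardsC [set i | x i != 0%R]; rewrite card_ord nz_card => NE.
  rewrite count_x -(congr1 (subn^~ (a + b)%N) NE) addKn.
  by apply: eq_card => i; rewrite !inE negbK.
- by rewrite count_x.
- by rewrite count_x.
Qed.
End Inertia.

(** * Rooting a tree at a vertex *)

Definition rooted_by (T : finType) (e : rel T) (r : T) (par : T -> T)
    (h : T -> nat) : Prop :=
  [/\ par r = r, h r = 0, (forall v, v != r -> h v = (h (par v)).+1) &
      (forall u v, e u v = (v != r) && (u == par v) || (u != r) && (v == par u))].

(** A path from [u] to [p] that avoids [v] would close up through [v] to a cycle. *)
Lemma tree_no_detour (T : finType) (e : rel T) (u p v : T) :
  is_tree e -> u != p -> e u v -> e p v ->
  ~ connect [rel a b | [&& e a b, a != v & b != v]] u p.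
Proof.
case=> [[esym eirr] _ acyc] up uv pv /connectP[q gq pE].
case/shortenP: gq pE => q' gq' uniq_q' _ pE.
have eq' : path e u q' by apply: sub_path gq' => a b /and3P[].
have vq' : v \notin q'.
  elim: q' u gq' {up uv uniq_q' pE eq'} => //= c q' IH u /andP[/and3P[_ _ cv] /IH].
  by rewrite inE negb_or eq_sym cv.
have uv_neq : v != u by apply: contraTneq uv => ->; rewrite eirr.
have /acyc : uniq [:: v, u & q'].
  by rewrite cons_uniq uniq_q' inE negb_or uv_neq vq'.
rewrite /= esym uv rcons_path eq' -pE pv => /(_ isT).
(* Acyclicity bounds the cycle by two vertices, so [q'] is empty and [u = p]. *)
by case: q' pE {gq' uniq_q' eq' vq'} => //= pE; rewrite pE eqxx in up.
Qed.

Lemma walkk_cons (T : finType) (e : rel T) k (x y z : T) :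
  e x z -> walkk e k z y -> walkk e k.+1 x y.
Proof. by move=> xz zy; apply/existsP; exists z; apply/andP. Qed.

(* [h] is the distance to [r] and [par v] a neighbour of [v] closer to [r]; any
   other neighbour [u] with [h u <= h v] would close a cycle through the root. *)
Lemma tree_rooted (T : finType) (e : rel T) (r : T) :
  is_tree e -> exists par h, rooted_by e r par h.
Proof.
move=> tree; have [[esym eirr] conn _] := tree.
have walk_ex v : exists k, walkk e k v r.
  have /connectP[p] := conn v r.
  elim: p v => [|u p IH] v /=; first by move=> _ ->; exists 0; exact: eqxx.
  case/andP=> vu up rE; have [k uk] := IH _ up rE.
  by exists k.+1; apply: walkk_cons uk.
pose h v := ex_minn (walk_ex v).
have h_walk v : walkk e (h v) v r by rewrite /h; case: ex_minnP.
have h_min v k : walkk e k v r -> h v <= k.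
  by rewrite /h; case: ex_minnP => m _; apply.
have h_edge u v : e u v -> h u <= (h v).+1.
  by move=> uv; apply: h_min; apply: walkk_cons uv (h_walk v).
have h_r : h r = 0 by apply/eqP; rewrite -leqn0; apply: h_min; exact: eqxx.
have h_down v : v != r -> exists u, e v u && ((h u).+1 == h v).
  move=> vr; have := h_walk v; case E: (h v) => [|k] /=.
    by rewrite (negPf vr).
  case/existsP=> u /andP[vu uk]; exists u; rewrite vu eqSS eqn_leq h_min //=.
  by rewrite -ltnS -E h_edge.
(* For [v != r] the [pick] succeeds by [h_down], so the default of [odflt] never shows. *)
pose par v := if v == r then r else odflt r [pick u | e v u && ((h u).+1 == h v)].
have parP v : v != r -> e v (par v) /\ h v = (h (par v)).+1.
  move=> vr; rewrite /par (negPf vr); case: pickP => [u /andP[? /eqP] //|no].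
  by have [u] := h_down v vr; rewrite no.
(* Climbing from [w], the depth drops strictly below [h v] at the first step, so [v] is never
   met. *)
have to_root v w : v != r -> h w <= h v -> w != v ->
    connect [rel a b | [&& e a b, a != v & b != v]] w r.
  move=> vr; have [k] := ubnP (h w); elim: k w => // k IH w wk wv w_neq.
  have [->|wr] := eqVneq w r; first exact: connect0.
  have [ew hw] := parP w wr.
  have pw : par w != v by apply: contraTneq wv => <-; rewrite hw ltnn.
  apply: connect_trans (IH _ _ _ pw); first by apply: connect1; rewrite /= ew w_neq.
    by rewrite -ltnS -hw.
  by rewrite ltnW // -hw.
have edge_par u v : e u v -> h u <= h v -> (v != r) && (u == par v).
  move=> uv huv; have uv_neq : u != v by apply: contraTneq uv => ->; rewrite eirr.
  have vr : v != r.
    apply: contraNneq uv_neq => vr; move: huv; rewrite vr h_r leqn0.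
    by apply: contraTT => ur; have [_ ->] := parP u ur.
  rewrite vr /=; have [ev hv] := parP v vr.
  apply/negPn/negP => up; apply: (tree_no_detour tree up uv); rewrite 1?esym //.
  apply: connect_trans (to_root _ _ vr huv uv_neq) _.
  rewrite sym_connect_sym; last first.
    by move=> a b /=; rewrite esym [(a != v) && _]andbC.
  apply: to_root => //; first by rewrite hv.
  by apply: contraTneq ev => ->; rewrite eirr.
exists par, h; split=> //; first by rewrite /par eqxx.
  by move=> v /parP[].
move=> u v; apply/idP/orP => [uv|[]/andP[nr /eqP->]].
- have vu : e v u by rewrite esym.
  have [|/ltnW] := leqP (h u) (h v); first by left; exact: edge_par.
  by right; exact: edge_par.
- by rewrite esym; case: (parP _ nr).
- by case: (parP _ nr).
Qed.

Lemma find_iota_min (a : pred nat) (n k : nat) :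
  k < n -> a k -> (forall i, a i -> k <= i) -> find a (iota 0 n) = k.
Proof.
move=> kn ak kmin; have -> : n = k + (n - k) by rewrite subnKC // ltnW.
rewrite iotaD find_cat ifF; last first.
  apply/hasP => -[j]; rewrite mem_iota => /andP[_ jk] /kmin.
  by rewrite leqNgt -[k]add0n jk.
by rewrite size_iota; case E: (n - k) => [|m] /=; [lia | rewrite ak addn0].
Qed.

Lemma bigmax_const (I : finType) (P : pred I) (F : I -> nat) (c : nat) :
  (exists i, P i) -> (forall i, P i -> F i = c) -> \max_(i | P i) F i = c.
Proof.
move=> [i0 Pi0] FE; apply/eqP; rewrite eqn_leq; apply/andP; split.
  by apply/bigmax_leqP => i /FE ->.
by rewrite -{1}(FE i0 Pi0); exact: leq_bigmax_cond.
Qed.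

Lemma leaf_edge_uniq (T : finType) (e : rel T) v a b :
  v \in leaves e -> e v a -> e v b -> a = b.
Proof.
rewrite inE => /cards1P[c Nv] va vb.
by have := in_set1 a c; have := in_set1 b c; rewrite -Nv !inE va vb => /esym/eqP-> /esym/eqP->.
Qed.

Lemma nonleaf_other_edge (T : finType) (e : rel T) v a :
  v \notin leaves e -> e v a -> exists2 b, e v b & b != a.
Proof.
rewrite inE => v_nleaf va; have [/existsP[b /andP[vb ba]]|no] :=
  boolP [exists b, e v b && (b != a)]; first by exists b.
case/negP: v_nleaf; apply/cards1P; exists a; apply/setP => b; rewrite !inE.
apply/idP/eqP => [vb|->//]; apply/eqP/negPn/negP => ba.
by case/existsP: no; exists b; rewrite vb.
Qed.

(** * Ancestors in the rooted tree *)

Section Rooted.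
Variables (T : finType) (e : rel T) (r : T) (par : T -> T) (h : T -> nat).
Hypothesis rooted : rooted_by e r par h.

Let par_root : par r = r. Proof. by case: rooted. Qed.
Let h_root : h r = 0. Proof. by case: rooted. Qed.
Let h_par v : v != r -> h v = (h (par v)).+1. Proof. by case: rooted => _ _ + _; apply. Qed.
Let edgeE u v : e u v = (v != r) && (u == par v) || (u != r) && (v == par u).
Proof. by case: rooted. Qed.

(** [anc v w] says that [w] lies in the subtree hanging from [v], the vertex [v] included. *)
Definition anc (v w : T) : bool := fconnect par w v.

Lemma ancP v w : reflect (exists k, v = iter k par w) (anc v w).
Proof.
apply: (iffP idP) => [vw|[k ->]]; last exact: fconnect_iter.
by exists (findex par w v); rewrite iter_findex.
Qed.

Lemma anc_refl v : anc v v. Proof. exact: connect0. Qed.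

Lemma anc_trans u v w : anc u v -> anc v w -> anc u w.
Proof. by move=> uv vw; apply: connect_trans vw uv. Qed.

Lemma anc_par v w : anc v w = (v == w) || anc v (par w).
Proof.
apply/idP/orP => [/ancP[[|k] ->]|[/eqP->|]]; first by left.
- by right; rewrite iterSr; exact: fconnect_iter.
- exact: anc_refl.
- by move/anc_trans; apply; exact: fconnect1.
Qed.

Lemma anc_depth v w : anc v w -> v != w -> h v < h w.
Proof.
move=> /ancP[k ->]; elim: k => [|k IH] /=; first by rewrite eqxx.
set x := iter k par w in IH *.
have [xr|xr] := eqVneq x r; first by rewrite xr par_root -xr.
have hx := h_par xr; have [<- _|xw _] := eqVneq x w; first by rewrite hx.
by apply: leq_trans (ltnW (IH xw)); rewrite hx.
Qed.

Lemma anc_parF v : v != r -> anc v (par v) = false.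
Proof.
move=> vr; apply/negP => vp; have hv := h_par vr.
have := anc_depth vp; rewrite hv ltnNge leqnSn /=.
by have [vE _|_ /(_ isT)] := eqVneq v (par v); first by rewrite -vE in hv; lia.
Qed.

Lemma anc_rootF v : v != r -> anc v r = false.
Proof. by move=> vr; apply/negP => /anc_depth/(_ vr); rewrite h_root. Qed.

(** Two ancestors of [w] are both iterates of [par] at [w]; thus subtrees that meet are nested. *)
Lemma anc_total u v w : anc u w -> anc v w -> anc u v || anc v u.
Proof.
move=> /ancP[j ->] /ancP[k ->]; case/orP: (leq_total j k) => /subnK <-.
  by apply/orP; right; rewrite iterD; exact: fconnect_iter.
by apply/orP; left; rewrite iterD; exact: fconnect_iter.
Qed.

(** * Distance as a count of separating edges *)

(** Each [v != r] stands for the edge from [v] to [par v]; the summand tells whether this edge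
    separates [w] from [x]. *)
Definition separations (w x : T) : nat := \sum_(v | v != r) (anc v w != anc v x).

Lemma separations_refl w : separations w w = 0.
Proof. by rewrite /separations big1 // => v _; rewrite eqxx. Qed.

Lemma separations_sym w x : separations w x = separations x w.
Proof. by apply: eq_bigr => v _; rewrite eq_sym. Qed.

Lemma separations_triangle z w x :
  separations w x <= separations w z + separations z x.
Proof.
rewrite -big_split; apply: leq_sum => v _ /=.
by case: (anc v w); case: (anc v x); case: (anc v z).
Qed.

(** Only the subtree hanging from [w] tells [w] from [par w]. *)
Lemma separations_parent w x :
  w != r -> ~~ anc w x -> separations w x = (separations (par w) x).+1.
Proof.
move=> wr wx; rewrite /separations (bigD1 w) //= [in RHS](bigD1 w) //=.
rewrite anc_refl anc_parF // (negPf wx) /= add1n add0n.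
congr _.+1; apply: eq_bigr => v /andP[_ vw].
by rewrite (anc_par v w) (negPf vw).
Qed.

Lemma separations_edge w x : e w x -> separations w x = 1.
Proof.
have up v : v != r -> separations v (par v) = 1.
  by move=> vr; rewrite separations_parent ?anc_parF // separations_refl.
rewrite edgeE => /orP[]/andP[nr /eqP->]; last exact: up.
by rewrite separations_sym up.
Qed.

Lemma separations_walk k w x : walkk e k w x -> separations w x <= k.
Proof.
elim: k w => [|k IH] w /=.
  by move/eqP->; rewrite separations_refl.
case/existsP=> z /andP[wz /IH zx].
by rewrite (leq_trans (separations_triangle z w x)) // separations_edge.
Qed.

Lemma walkk_rcons k w z x : walkk e k w z -> e z x -> walkk e k.+1 w x.
Proof.
elim: k w => [|k IH] w.
  move=> /eqP -> zx; apply: walkk_cons zx _; exact: eqxx.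
case/existsP=> y /andP[wy yz] zx.
by apply: walkk_cons wy (IH _ yz zx).
Qed.

(** Induction on the total depth: climb from an end point that is not an ancestor of the other,
    which lowers [separations] by one. *)
Lemma walk_separations w x : walkk e (separations w x) w x.
Proof.
have [m] := ubnP (h w + h x); elim: m w x => // m IH w x hm.
have [<-|wx] := eqVneq w x.
  by rewrite separations_refl /=.
have [anc_wx|nanc_wx] := boolP (anc w x).
  have xr : x != r.
    by apply: contraNneq wx => xr; move: (anc_wx); rewrite xr; case: eqVneq => // /anc_rootF->.
  have nanc_xw : ~~ anc x w.
    apply/negP => /anc_depth; rewrite eq_sym => /(_ wx) hxw.
    by have := anc_depth anc_wx wx; lia.
  rewrite separations_sym separations_parent // separations_sym.
  apply: (@walkk_rcons _ _ (par x)).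
    by apply: IH; move: hm; rewrite (h_par xr); lia.
  by rewrite edgeE xr eqxx.
have wr : w != r.
  apply: contraNneq nanc_wx => ->.
  (* The root is an ancestor of every vertex. *)
  have [k] := ubnP (h x); elim: k (x) => // k IHk y hy.
  have [->|yr] := eqVneq y r; first exact: anc_refl.
  by rewrite anc_par IHk ?orbT //; move: hy; rewrite (h_par yr).
rewrite separations_parent //; apply: (@walkk_cons _ _ _ _ _ (par w)).
  by rewrite edgeE wr eqxx orbT.
apply: IH.
by move: hm; rewrite (h_par wr); lia.
Qed.

Lemma dist_separations w x : dist e w x = separations w x.
Proof.
apply: find_iota_min (walk_separations w x) _; last by move=> k /separations_walk.
(* [dist] searches only lengths below [#|T|]; the [#|T| - 1] vertices other than [r] bound
   [separations]. *)
apply: (@leq_ltn_trans (\sum_(v | v != r) 1)).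
  by apply: leq_sum => v _; exact: leq_b1.
rewrite sum1_card (eq_card (_ : _ =i predC1 r)) // cardC1 prednK //.
by apply/card_gt0P; exists r.
Qed.

Lemma fourpt_separations w x y z :
  let k v := anc v w + anc v x + anc v y + anc v z in
  fourpt e w x y z = \sum_(v | v != r) minn (k v) (4 - k v).
Proof.
move=> k; rewrite /fourpt !dist_separations /separations -!big_split /=.
pose m v := minn (k v) (4 - k v); rewrite -[RHS]/(\sum_(v | v != r) m v).
set S1 := \sum_(v | _) _; set S2 := \sum_(v | _) _; set S3 := \sum_(v | _) _.
have le1 : S1 <= \sum_(v | v != r) m v.
  apply: leq_sum => v _; rewrite /m /k.
  by case: (anc v w); case: (anc v x); case: (anc v y); case: (anc v z).
have le2 : S2 <= \sum_(v | v != r) m v.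
  apply: leq_sum => v _; rewrite /m /k.
  by case: (anc v w); case: (anc v x); case: (anc v y); case: (anc v z).
have le3 : S3 <= \sum_(v | v != r) m v.
  apply: leq_sum => v _; rewrite /m /k.
  by case: (anc v w); case: (anc v x); case: (anc v y); case: (anc v z).
(* [S1] misses the bound only at an edge cutting [{w, x}] from [{y, z}], and [S2] only at one
   cutting [{w, y}] from [{x, z}]; the two kinds of cut exclude each other. *)
suff [SE|SE] : S1 = \sum_(v | v != r) m v \/ S2 = \sum_(v | v != r) m v.
- by rewrite SE; apply/maxn_idPl; rewrite geq_max le2 le3.
- by rewrite maxnCA SE; apply/maxn_idPl; rewrite geq_max le1 le3.
have [/forall_inP eq1|] := boolP [forall (v | v != r),
    (anc v w != anc v x) + (anc v y != anc v z) == m v].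
  by left; apply: eq_bigr => v vr; apply/eqP/eq1.
case/forall_inPn=> v _ bad_v; right; apply: eq_bigr => u _.
(* Subtrees hanging below [u] and [v] that meet are nested, so they cannot cut
   the four points along two different pairings. *)
have nest a b c : anc u a -> anc v a -> anc u b -> anc v c -> anc v b || anc u c.
  move=> ua va ub vc; have /orP[uv|vu] := anc_total ua va.
    by rewrite (anc_trans uv vc) orbT.
  by rewrite (anc_trans vu ub).
move: bad_v (nest w x y) (nest w y x) (nest x w z) (nest x z w)
  (nest y w z) (nest y z w) (nest z x y) (nest z y x); rewrite /m /k.
case: (anc v w); case: (anc v x); case: (anc v y); case: (anc v z) => //= _;
  case: (anc u w); case: (anc u x); case: (anc u y); case: (anc u z) => //=;
  by intuition.
Qed.

(** * Matrix entries as sums over edges *)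

Definition below (v : T) (A : {set T}) : nat := \sum_(w in A) anc v w.

Lemma below_pair v w x : w != x -> below v [set w; x] = anc v w + anc v x.
Proof. by move=> wx; rewrite /below big_setU1 ?inE // big_set1. Qed.

Lemma below_le v (A : {set T}) : #|A| = 2 -> below v A <= 2.
Proof. by move=> <-; rewrite -sum1_card; apply: leq_sum => w _; exact: leq_b1. Qed.

Lemma pair_eq (A : {set T}) w x :
  #|A| = 2 -> w \in A -> x \in A -> x != w -> A = [set w; x].
Proof.
move=> A2 wA xA xw; apply/esym/eqP; rewrite eqEcard cards2 eq_sym xw A2 leqnn.
by rewrite andbT; apply/subsetP => y; rewrite !inE => /orP[]/eqP->.
Qed.

Lemma max4pc_entryE (A B : {set T}) : #|A| = 2 -> #|B| = 2 ->
  max4pc_entry e A B = \sum_(v | v != r)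
    minn (below v A + below v B) (4 - (below v A + below v B)).
Proof.
have pair_ex (X : {set T}) : #|X| = 2 -> exists w, w \in X.
  by move=> X2; apply/card_gt0P; rewrite X2.
have other (X : {set T}) w : #|X| = 2 -> w \in X -> exists x, (x \in X) && (x != w).
  move=> X2 wX; have : 0 < #|X :\ w| by have := cardsD1 w X; rewrite wX X2; lia.
  by case/card_gt0P => x; rewrite !inE andbC; exists x.
move=> A2 B2; apply: bigmax_const => [|w wA]; first exact: pair_ex.
apply: bigmax_const => [|x /andP[xA xw]]; first exact: other.
apply: bigmax_const => [|y yB]; first exact: pair_ex.
apply: bigmax_const => [|z /andP[zB zy]]; first exact: other.
rewrite fourpt_separations (pair_eq A2 wA xA xw) (pair_eq B2 yB zB zy).
by apply: eq_bigr => v _; rewrite !below_pair 1?eq_sym // !addnA.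
Qed.

(** * Children and leaves of the rooted tree *)

Lemma anc_child v w : anc v w -> v != w -> exists2 c, c != r & par c = v.
Proof.
case/ancP=> k ->; elim: k => [|k IH] /=; first by rewrite eqxx.
set x := iter k par w in IH *.
have [xr|xr] := eqVneq x r; last by exists x.
have -> : par x = x by rewrite xr par_root.
exact: IH.
Qed.

Lemma edge_par v : v != r -> e v (par v).
Proof. by move=> vr; rewrite edgeE vr eqxx orbT. Qed.

Lemma edge_child v : v != r -> e (par v) v.
Proof. by move=> vr; rewrite edgeE vr eqxx. Qed.

Lemma par_neq c v : v != r -> par c = v -> c != r -> c != par v.
Proof.
move=> vr cv cr; apply/eqP => cE.
by have := h_par vr; have := h_par cr; rewrite cv -cE; lia.
Qed.

(** A child would be a second neighbour besides the parent. *)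
Lemma par_leafF v : v != r -> v \in leaves e -> forall c, c != r -> par c != v.
Proof.
move=> vr v_leaf c cr; apply/eqP => cv; have := par_neq vr cv cr.
rewrite (leaf_edge_uniq v_leaf (edge_par vr) (b := c)) ?eqxx //.
by rewrite -cv edge_child.
Qed.

Lemma anc_leaf v w : v != r -> v \in leaves e -> anc v w = (v == w).
Proof.
move=> vr v_leaf; have [->|vw] := eqVneq v w; first exact: anc_refl.
apply/negP => /anc_child/(_ vw)[c cr cv].
by have := par_leafF vr v_leaf cr; rewrite cv eqxx.
Qed.

(** The form with [(+)] can be solved for either end, so an edge may be crossed upwards or
    downwards. *)
Lemma anc_addb y v : v != r -> anc y v = (y == v) (+) anc y (par v).
Proof.
move=> vr; rewrite anc_par; have [->|//] := eqVneq y v.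
by rewrite anc_parF.
Qed.

(** A deepest vertex has no child. *)
Lemma leaf_exists : 1 < #|T| -> exists x, x \in leaves e.
Proof.
move=> T2; pose x := [arg max_(x > r) h x].
have x_max y : h y <= h x by rewrite /x; case: arg_maxnP => // i _; apply.
have xr : x != r.
  have /card_gt0P[y] : 0 < #|predC1 r| by rewrite cardC1; lia.
  rewrite !inE => yr; apply: contraTneq (x_max y) => ->.
  by rewrite h_root -ltnNge h_par.
exists x; rewrite inE; apply/cards1P; exists (par x); apply/setP => y.
rewrite !inE edgeE xr andTb orbC; case: eqP => //= _; apply/negP => /andP[yr /eqP xE].
by have := x_max y; rewrite (h_par yr) -xE ltnn.
Qed.

Hypothesis root_nonleaf : r \notin leaves e.

Lemma par_nonleaf v : v != r -> par v \notin leaves e.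
Proof.
move=> vr; have [->//|pr] := eqVneq (par v) r; apply/negP => p_leaf.
by have := par_leafF pr p_leaf vr; rewrite eqxx.
Qed.

Lemma leaf_neq_root v : v \in leaves e -> v != r.
Proof. by apply: contraTneq => ->. Qed.

Lemma below_leaf v (A : {set T}) : v \in leaves e -> below v A = (v \in A).
Proof.
move=> v_leaf; have vr := leaf_neq_root v_leaf.
rewrite /below (eq_bigr (fun w => (v == w) : nat)); last first.
  by move=> w _; rewrite anc_leaf.
have [vA|vA] := boolP (v \in A).
  by rewrite (bigD1 v) //= eqxx big1 // => w /andP[_]; rewrite eq_sym => /negPf->.
by rewrite big1 // => w wA; case: eqP wA vA => // -> ->.
Qed.

(** * The Gram decomposition and the independence of its rows *)

Section Gram.
Local Open Scope ring_scope.
Variable R : realType.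
Local Notation inner := (~: leaves e).

(* The second summand is half the number of inner edges, so that
   [leaf_height A + leaf_height B] collects the constant [1] of each of them. *)
Definition leaf_height (A : {set T}) : R :=
  (\sum_(v in leaves e) below v A)%:R + (#|inner|.-1)%:R / 2.

(* At the root, [pos_part r A * pos_part r B - neg_part r A * neg_part r B] is
   [leaf_height A + leaf_height B]. *)
Definition pos_part (v : T) (A : {set T}) : R :=
  if v == r then leaf_height A / 2 + 1 else (below v A == 1)%:R.

Definition neg_part (v : T) (A : {set T}) : R :=
  if v == r then leaf_height A / 2 - 1 else (below v A)%:R - 1.

Lemma max4pc_entry_gram (A B : {set T}) : #|A| = 2 -> #|B| = 2 ->
  (max4pc_entry e A B)%:R = \sum_(v in inner)
    (pos_part v A * pos_part v B - neg_part v A * neg_part v B).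
Proof.
move=> A2 B2; rewrite max4pc_entryE // natr_sum.
rewrite (bigID (mem (leaves e))) /= [RHS](bigD1 r) /=; last by rewrite in_setC.
(* At a leaf [below] is 0 or 1, so [k] is at most 2 and [minn k (4 - k)] is [k]. *)
have leafE : \sum_(v | (v != r) && (v \in leaves e))
      (minn (below v A + below v B) (4 - (below v A + below v B)))%:R
    = (\sum_(v in leaves e) below v A)%:R
      + (\sum_(v in leaves e) below v B)%:R :> R.
  rewrite -natrD -natr_sum -big_split /=; congr _%:R; apply: eq_big => v.
    by apply: andb_idl; exact: leaf_neq_root.
  by case/andP=> _ v_leaf; rewrite !below_leaf //; case: (v \in A); case: (v \in B).
(* Each inner edge contributes a constant 1, and there is one such edge for each inner vertex but
   the root. *)
have innerE : \sum_(v | (v != r) && (v \notin leaves e))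
      (minn (below v A + below v B) (4 - (below v A + below v B)))%:R
    = (#|inner|.-1)%:R + \sum_(v in inner | v != r)
        (pos_part v A * pos_part v B - neg_part v A * neg_part v B).
  have -> : #|inner|.-1 = (\sum_(v in inner | v != r) 1)%N.
    rewrite sum1_card (cardsD1 r) in_setC root_nonleaf add1n /=.
    by apply: eq_card => v; rewrite in_setD1 andbC.
  rewrite natr_sum -big_split; apply: eq_big => [v|v /andP[vr v_leaf]] /=.
    by rewrite in_setC andbC.
  rewrite /pos_part /neg_part (negPf vr).
  have := below_le v A2; have := below_le v B2.
  case: (below v A) => [|[|[|]]] //; case: (below v B) => [|[|[|]]] // _ _;
    rewrite /minn /= ?(addSn, add0n, subSS, subn0) /=; lra.
rewrite leafE innerE /pos_part /neg_part eqxx /leaf_height; by field.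
Qed.

(* Evaluating a relation on the four pairs {u, u'}, {v, v'}, {u, v}, {u', v'}
   of a path u', u, v, v' isolates the coefficient of the edge uv. *)
Lemma separated_path y s u u' v v' :
  s != v -> s != v' -> v != v' ->
  anc y u' = (y == s) (+) anc y u -> anc y v = (y == v) (+) anc y u ->
  anc y v' = (y == v') (+) anc y v ->
  (anc y u != anc y u')%:R + (anc y v != anc y v')%:R
    - (anc y u != anc y v)%:R - (anc y u' != anc y v')%:R
  = - 2 * (y == v)%:R :> R.
Proof.
move=> sv sv' vv' -> -> ->.
have [->|ys] := eqVneq y s; first by rewrite (negPf sv) (negPf sv'); case: (anc s u) => /=; lra.
have [->|yv] := eqVneq y v; first by rewrite (negPf vv'); case: (anc v u) => /=; lra.
by case: (y == v'); case: (anc y u) => /=; lra.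
Qed.

(** On a pair [{w, x}] the relation consists of a [tau]-weighted count of separating edges, a
    function [g] of each end point and a constant. Second differences along paths of three edges
    give [tau]; then [g] is constant, which gives [sigma]; the root coefficients come last. *)
Lemma parts_free (tau sigma : T -> R) :
  (2 < #|T|)%N ->
  (forall A : {set T}, #|A| = 2 ->
     \sum_(v in inner) (tau v * pos_part v A + sigma v * neg_part v A) = 0) ->
  forall v, v \in inner -> tau v = 0 /\ sigma v = 0.
Proof.
move=> T3 rel.
(* [g] collects the terms depending on one end point, and [c] the constants, among them those of
   [leaf_height]. *)
pose g w : R := \sum_(v in inner | v != r) sigma v * (anc v w)%:R
  + (tau r + sigma r) / 2 * (w \in leaves e)%:R.
pose c : R := (tau r + sigma r) / 4 * (#|inner|.-1)%:R + tau r - sigma r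
  - \sum_(v in inner | v != r) sigma v.
have relE w x : w != x ->
    \sum_(v in inner | v != r) tau v * (anc v w != anc v x)%:R
      + g w + g x + c = 0.
  move=> wx; rewrite -[RHS](rel [set w; x]); last by rewrite cards2 wx.
  rewrite [RHS](bigD1 r) /=; last by rewrite in_setC.
  have leafE : (\sum_(v in leaves e) below v [set w; x])%N
      = ((w \in leaves e) + (x \in leaves e))%N.
    have count1 y : (\sum_(v in leaves e) (v == y) = (y \in leaves e))%N.
      have [yl|yl] := boolP (y \in leaves e).
        by rewrite (bigD1 y) //= eqxx big1 // => v /andP[_ /negPf->].
      by rewrite big1 // => v vl; case: eqP vl yl => // -> ->.
    rewrite -!count1 -big_split; apply: eq_bigr => v v_leaf /=.
    by rewrite below_pair // !anc_leaf // leaf_neq_root.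
  have -> : \sum_(v in inner | v != r)
        (tau v * pos_part v [set w; x] + sigma v * neg_part v [set w; x])
      = \sum_(v in inner | v != r) tau v * (anc v w != anc v x)%:R
        + \sum_(v in inner | v != r) sigma v * (anc v w)%:R
        + \sum_(v in inner | v != r) sigma v * (anc v x)%:R
        - \sum_(v in inner | v != r) sigma v.
    rewrite -!big_split -sumrB; apply: eq_bigr => v /andP[_ vr].
    rewrite /pos_part /neg_part (negPf vr) below_pair // natrD.
    by case: (anc v w); case: (anc v x) => /=; lra.
  rewrite /pos_part /neg_part eqxx /leaf_height leafE natrD /g /c; by field.
have tau0 v : v \in inner -> v != r -> tau v = 0.
  rewrite in_setC => v_in vr.
  (* The edge from [v] to its parent [u] is the middle of a path [u', u, v, v'], since neither end
     is a leaf. *)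
  have [v' vv' v'p] := nonleaf_other_edge v_in (edge_par vr).
  have [v'r v'E] : v' != r /\ par v' = v.
    by move: vv'; rewrite edgeE (negPf v'p) andbF orbF => /andP[? /eqP].
  have [u' uu' u'v] := nonleaf_other_edge (par_nonleaf vr) (edge_child vr).
  set u := par v in uu' *.
  have hv : h v = (h u).+1 := h_par vr.
  have hv' : h v' = (h v).+1 by rewrite (h_par v'r) v'E.
  have neq a b : (h a < h b)%N -> a != b.
    by move=> ab; apply: contraTneq ab => ->; rewrite ltnn.
  (* [s] is the lower end of the edge between [u] and [u']: either [u'] is a child of [u], or it is
     the parent of [u]. Depths then tell the vertices apart. *)
  have [s [sE hs]] : exists s, (forall y, anc y u' = (y == s) (+) anc y u) /\
      [/\ s != v, (h s <= h v)%N, (h u' <= h v)%N & h u != h u'].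
    move: uu'; rewrite edgeE => /orP[]/andP[nr /eqP pE].
      exists u'; split=> [y|]; first by rewrite (anc_addb _ nr) -pE.
      by rewrite hv (h_par nr) -pE ltn_eqF.
    exists u; split=> [y|]; first by rewrite (anc_addb y nr) -pE addbA addbb.
    have hu : h u = (h u').+1 by rewrite (h_par nr) -pE.
    have uv : u != v by apply: neq; rewrite hv.
    by split; rewrite ?hv ?hu //; lia.
  case: hs => sv hsv hu'v huu'.
  have E1 : u != u' by apply: contraNneq huu' => ->.
  have E2 : v != v' by apply: neq; rewrite hv'.
  have E3 : u != v by apply: neq; rewrite hv.
  have E4 : u' != v' by apply: neq; rewrite hv' ltnS.
  have sv' : s != v' by apply: neq; rewrite hv' ltnS.
  have := relE _ _ E4; have := relE _ _ E3; have := relE _ _ E2.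
  have := relE _ _ E1.
  set S1 := \sum_(y in _ | _) _; set S2 := \sum_(y in _ | _) _.
  set S3 := \sum_(y in _ | _) _; set S4 := \sum_(y in _ | _) _.
  suff : S1 + S2 - S3 - S4 = - 2 * tau v by lra.
  rewrite -big_split -!sumrB (bigD1 v) /=; last by rewrite in_setC v_in.
  have path y : (anc y u != anc y u')%:R + (anc y v != anc y v')%:R
      - (anc y u != anc y v)%:R - (anc y u' != anc y v')%:R
    = - 2 * (y == v)%:R :> R.
    apply: separated_path sv sv' E2 (sE y) (anc_addb y vr) _.
    by rewrite (anc_addb y v'r) v'E.
  rewrite -!(mulrDr, mulrBr) path eqxx mulr1 big1 => [|y /andP[_ yv]]; first lra.
  by rewrite -!(mulrDr, mulrBr) path (negPf yv) !mulr0.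
have g_const w x : g w = g x.
  have [->//|wx] := eqVneq w x.
  (* With [tau] gone, the relations on [{w, z}] and [{x, z}] for a third vertex [z] differ by
     [g w - g x]. *)
  have [z /andP[zw zx]] : exists z, (z != w) && (z != x).
    have : (0 < #|~: [set w; x]|)%N by have := cardsC [set w; x]; rewrite cards2 wx; lia.
    by case/card_gt0P => z; rewrite !inE negb_or; exists z.
  have := relE w z; have := relE x z.
  rewrite ![_ == z]eq_sym zw zx => /(_ isT) + /(_ isT).
  rewrite !big1; first lra.
    by move=> v /andP[vi vr]; rewrite tau0 ?mul0r.
  by move=> v /andP[vi vr]; rewrite tau0 ?mul0r.
have sigma0 v : v \in inner -> v != r -> sigma v = 0.
  (* Neither [v] nor [par v] is a leaf, and of the subtrees only that of [v] tells them apart, so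
     [g v - g (par v)] is [sigma v]. *)
  move=> vi vr; have := g_const v (par v); rewrite /g.
  rewrite in_setC in vi; rewrite (negPf vi) (negPf (par_nonleaf vr)).
  rewrite (bigD1 v) /=; last by rewrite in_setC vi.
  rewrite [in RHS](bigD1 v) /=; last by rewrite in_setC vi.
  rewrite anc_refl anc_parF //.
  rewrite [X in _ + X + _ = _](eq_bigr (fun y => sigma y * (anc y (par v))%:R)); last first.
    by move=> y /andP[_ yv]; rewrite anc_par (negPf yv).
  by move=> /=; lra.
have g_root : g r = 0.
  rewrite /g (negPf root_nonleaf) mulr0 addr0 big1 // => v /andP[_ vr].
  by rewrite anc_rootF // mulr0.
have [x x_leaf] := leaf_exists (ltnW T3).
(* At a leaf only the leaf term of [g] is left. *)
have sum0 : tau r + sigma r = 0.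
  have := g_const x r; rewrite g_root /g x_leaf big1 /=; first lra.
  by move=> v /andP[vi vr]; rewrite sigma0 ?mul0r.
(* The relation on [{x, r}] has shrunk to [c = 0]. *)
have diff0 : tau r - sigma r = 0.
  have := relE x r (leaf_neq_root x_leaf).
  rewrite big1; last by move=> v /andP[vi vr]; rewrite tau0 ?mul0r.
  rewrite (g_const x r) g_root /c big1; last by move=> v /andP[vi vr]; rewrite sigma0.
  by rewrite sum0; lra.
move=> v vi; have [->|vr] := eqVneq v r; first by split; lra.
by rewrite tau0 // sigma0.
Qed.

Definition part_mx (f : T -> {set T} -> R) : 'M[R]_(#|inner|, #|pairs T|) :=
  \matrix_(i, j) f (enum_val i) (enum_val j).

Lemma card_enum_pairs (j : 'I_#|pairs T|) : #|(enum_val j : {set T})| = 2.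
Proof. by apply/eqP; exact: (enum_valP j). Qed.

Lemma Max4PC_gram : Max4PC R e =
  (part_mx pos_part)^T *m part_mx pos_part
  - (part_mx neg_part)^T *m part_mx neg_part.
Proof.
apply/matrixP => i j.
rewrite !mxE max4pc_entry_gram ?card_enum_pairs // -sumrB big_enum_val.
by apply: eq_bigr => k _; rewrite !mxE.
Qed.

Lemma row_free_parts :
  (2 < #|T|)%N -> row_free (col_mx (part_mx pos_part) (part_mx neg_part)).
Proof.
move=> T3; rewrite -kermx_eq0; apply/rowV0P => u /sub_kermxP.
rewrite -[u]hsubmxK mul_row_col; set t := lsubmx u; set s := rsubmx u => tsE.
(* The root witnesses that [inner] is inhabited, as [enum_rank_in] requires. *)
have rI : r \in inner by rewrite in_setC.
pose coef (w : 'rV[R]_#|inner|) v := w 0 (enum_rank_in rI v).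
have rel (A : {set T}) : #|A| = 2 ->
    \sum_(v in inner) (coef t v * pos_part v A + coef s v * neg_part v A) = 0.
  move=> A2; have Ap : A \in pairs T by rewrite inE A2.
  have := congr1 (fun M : 'rV_#|pairs T| => M 0 (enum_rank_in Ap A)) tsE.
  rewrite !mxE => tsA; rewrite -[RHS]tsA -big_split [LHS]big_enum_val.
  apply: eq_bigr => i _ /=.
  by rewrite /coef !mxE enum_valK_in (enum_rankK_in _ Ap).
have coef0 := parts_free T3 rel.
have [-> ->] : t = 0 /\ s = 0; last by rewrite row_mx0.
split; apply/rowP => i; have [ti si] := coef0 _ (enum_valP i); rewrite [RHS]mxE.
  by rewrite /coef enum_valK_in in ti.
by rewrite /coef enum_valK_in in si.
Qed.

End Gram.
End Rooted.

(** * A non-leaf root and the conclusion *)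

(** If all vertices were leaves, every vertex other than [r0] would have parent [r0], and two of
    them would be distinct neighbours of the leaf [r0]. *)
Lemma tree_nonleaf (T : finType) (e : rel T) :
  is_tree e -> 2 < #|T| -> exists r, r \notin leaves e.
Proof.
move=> tree T3; have /card_gt0P[r0 _] : 0 < #|T| by lia.
have [par [h rooted]] := tree_rooted r0 tree.
have [] := boolP [exists r, r \notin leaves e]; first by case/existsP=> r; exists r.
move=> /existsPn all_leaf; have {}all_leaf v : v \in leaves e.
  by have := all_leaf v; rewrite negbK.
have par_r0 v : v != r0 -> par v = r0.
  move=> vr; apply/eqP/negPn/negP => pr.
  by have := par_leafF rooted pr (all_leaf _) vr; rewrite eqxx.
have /card_gt1P[w [x [wr xr wx]]] : 1 < #|predC1 r0| by rewrite cardC1; lia.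
rewrite !inE in wr xr; case/eqP: wx.
by apply: (leaf_edge_uniq (all_leaf r0));
  [rewrite -(par_r0 w wr)|rewrite -(par_r0 x xr)]; exact: (edge_child rooted).
Qed.

Theorem mainTheorem8 (R : realType) (T : finType) (e : rel T) (n p : nat) :
  is_tree e -> #|T| = n -> 3 <= n -> #|leaves e| = p ->
  has_inertia (Max4PC R e) ('C(n, 2) - 2 * (n - p)) (n - p) (n - p).
Proof.
move=> tree Tn n3 Lp; rewrite -Tn in n3.
have [r r_nonleaf] := tree_nonleaf tree n3.
have [par [h rooted]] := tree_rooted r tree.
have -> : n - p = #|~: leaves e| by rewrite cardsCs setCK Tn Lp.
have -> : 'C(n, 2) = #|pairs T|.
  by rewrite -Tn -card_draws; apply: eq_card => A; rewrite !inE.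
rewrite (Max4PC_gram rooted r_nonleaf) mul2n -addnn.
apply: has_inertia_gram_diff; exact: row_free_parts rooted r_nonleaf R n3.
Qed.
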